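(* Let $p$ be any prime, let $n,k,l$ be positive integers with $l\mid k$, and put $d=\gcd(n,k)$, $e=\gcd(n,l)$, $L=\operatorname{lcm}(d,l)$. Suppose that $\frac{k}{l}$ is odd. 1. When $\frac{n}{d}$ is odd, $$\{x\in \mathbb{F}_{p^n}\mid S_l^k(x)=0\}=\{0\},$$ and consequently $\#\{x\in \mathbb{F}_{p^n}\mid S_l^k(x)=0\}=1$. 2. When $\frac{n}{d}$ is even, $$\{x\in \mathbb{F}_{p^n}\mid S_l^k(x)=0\}=\begin{cases}S_d^{2d}(\mathbb{F}_{p^{2d}}), & \text{if } p\mid \frac{k}{L},\\ S_d^{2d}\circ T_e^{2e}(\mathbb{F}_{p^{2d}}), & \text{otherwise,}\end{cases}$$ and consequently $$\#\{x\in \mathbb{F}_{p^n}\mid S_l^k(x)=0\}=\begin{cases}p^{d}, & \text{if } p\mid \frac{k}{L},\\ p^{d-e}, & \text{otherwise.}\end{cases}$$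
   Context: For positive integers $u\mid v$ and a prime $p$, define the linearized polynomials $T_u^v(X)=\sum_{i=0}^{v/u-1}X^{p^{ui}}$ and $S_u^v(X)=\sum_{i=0}^{v/u-1}(-1)^iX^{p^{ui}}$; in particular $T_u^{2u}(X)=X+X^{p^u}$ and $S_u^{2u}(X)=X-X^{p^u}$. All finite fields $\mathbb{F}_{p^m}$ are regarded as subfields of a fixed algebraic closure $\overline{\mathbb{F}_p}$. For a polynomial $F$ and a set $A$, $F(A)=\{F(x)\mid x\in A\}$. Since $d\mid k$ and $l\mid k$, $L$ divides $k$, and $e\mid d$.
   Formalization: In part 1 the extra hypothesis ''p is odd or d = e'' is added: for p = 2 the claim fails when d ≠ e (e.g. p=2, n=k=3, l=1, where S_1^3 is the trace on F_8 with a 4-element kernel) and holds when d = e. *)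

(* Defs.v *)
(* MathComp, with the sets and cardinalities of mathcomp-classical *)
From HB Require Import structures.
From mathcomp Require Import all_boot all_order all_algebra all_field.
From mathcomp Require Import finmap.
From mathcomp Require Import boolp classical_sets functions cardinality.

Set Implicit Arguments.
Unset Strict Implicit.
Unset Printing Implicit Defensive.

Import GRing.Theory.

Local Open Scope classical_set_scope.
Local Open Scope card_scope.
Local Open Scope ring_scope.

(* Both polynomials are only meant for positive u dividing v. *)
Definition Tpoly (R : nzRingType) (p u v : nat) : {poly R} :=
  \sum_(0 <= i < v %/ u) 'X^(p ^ (u * i)).

Definition Spoly (R : nzRingType) (p u v : nat) : {poly R} :=
  \sum_(0 <= i < v %/ u) (-1) ^+ i *: 'X^(p ^ (u * i)).

Definition poly_image (R : nzRingType) (F : {poly R}) (A : set R) : set R :=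
  [set F.[x] | x in A].

(* The subfield of order p ^ m of an algebraic closure K of 'F_p; that it is   *)
(* the one and only subfield with p ^ m elements is proved below.              *)
Definition GFset (K : closedFieldType) (p m : nat) : set K :=
  [set x | x ^+ (p ^ m) = x].
Arguments GFset : clear implicits.

Lemma Tpoly_double (R : nzRingType) (p u : nat) :
  (0 < u)%N -> Tpoly R p u (2 * u) = 'X + 'X^(p ^ u).
Proof.
by move=> u0; rewrite /Tpoly mulnK // !big_nat_recr //= big_geq // add0r
  muln0 muln1 expn0 expr1.
Qed.

Lemma Spoly_double (R : nzRingType) (p u : nat) :
  (0 < u)%N -> Spoly R p u (2 * u) = 'X - 'X^(p ^ u).
Proof.
by move=> u0; rewrite /Spoly mulnK // !big_nat_recr //= big_geq // add0r
  muln0 muln1 expn0 !expr1 expr0 scale1r scaleN1r.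
Qed.

Lemma GFset_subfield (K : closedFieldType) (p m : nat) :
  p \in [pchar K] -> divring_closed (fun x : K => x \in GFset K p m).
Proof.
move=> pK; have pn : [pchar K].-nat (p ^ m)%N.
  by rewrite (eq_pnat _ (pcharf_eq pK)) pnatX pnat_id ?(pcharf_prime pK).
split=> [|x y|x y]; rewrite !unfold_in.
- by apply/mem_set; rewrite /GFset /= expr1n.
- move=> /set_mem xm /set_mem ym; apply/mem_set.
  by rewrite /GFset /= exprDn_pchar // exprNn_pchar // xm ym.
- move=> /set_mem xm /set_mem ym; apply/mem_set.
  by rewrite /GFset /= exprMn exprVn xm ym.
Qed.

Lemma GFset_card (K : closedFieldType) (p m : nat) :
  p \in [pchar K] -> (0 < m)%N -> GFset K p m #= `I_(p ^ m).
Proof.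
move=> pK m0; have p1 := prime_gt1 (pcharf_prime pK).
have q1 : (1 < p ^ m)%N by rewrite -(exp1n m) ltn_exp2r.
pose P : {poly K} := 'X^(p ^ m) - 'X.
have sP : size P = (p ^ m).+1.
  by rewrite size_polyDl ?size_polyXn // size_polyN size_polyX.
have [r Pr] := closed_field_poly_normal P.
have P0 : P != 0 by rewrite -size_poly_eq0 sP.
have lP : lead_coef P != 0 by rewrite lead_coef_eq0.
have ur : uniq r.
  rewrite -separable_prod_XsubC -(eqp_separable (eqp_scale _ lP)) -Pr unlock.
  have -> : P^`() = (-1)%:P.
    rewrite derivB derivXn derivX -mulr_natl natrX -(rmorph_nat polyC).
    by rewrite (pcharf0 pK) expr0n gtn_eqF // mul0r sub0r polyCN.
  by rewrite -alg_polyC coprimepZr ?coprimep1 // oppr_eq0 oner_eq0.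
have sr : size r = (p ^ m)%N.
  by apply/eqP; rewrite -eqSS -sP Pr size_scale // size_prod_XsubC.
have rP x : (x \in r) = (x ^+ (p ^ m) == x).
  by rewrite -root_prod_XsubC -(rootZ _ _ lP) -Pr rootE !hornerE subr_eq0.
have -> : GFset K p m = [set` [fset x in r]%fset].
  by apply/seteqP; split=> x /=; rewrite !inE /= rP => /eqP.
by apply/card_eq_fsetP; rewrite card_fseq undup_id.
Qed.

Lemma GFset_unique (K : closedFieldType) (p m : nat) (A : set K) :
  divring_closed (fun x : K => x \in A) -> A #= `I_(p ^ m) -> A = GFset K p m.
Proof.
move=> Adiv Acard; have [A1 AB AV] := Adiv.
have Afin : finite_set A by exists (p ^ m)%N.
pose B := fset_set A.
have inB x : (x \in B) = (x \in A) by rewrite in_fset_set.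
have A0 : 0 \in A by have := AB _ _ A1 A1; rewrite subrr.
have AM x y : x \in A -> y \in A -> x * y \in A.
  by move=> xA yA; rewrite -[y]invrK; apply: (AV) => //; rewrite -div1r; apply: (AV).
have sB : #|` B| = (p ^ m)%N by exact: card_fset_set.
pose C := (B `\ 0)%fset.
have sC : (#|` C|).+1 = (p ^ m)%N by rewrite -sB (cardfsD1 0 B) inB A0.
have inC x : (x \in C) = (x != 0) && (x \in A) by rewrite !inE inB.
have C1 : (0 < #|` C|)%N.
  by rewrite cardfs_gt0; apply/fset0Pn; exists 1; rewrite inC oner_eq0.
have AF : A `<=` GFset K p m.
  move=> x /mem_set xA; rewrite /GFset /=.
  have [->|x0] := eqVneq x 0; first by rewrite expr0n -sC.
  have xC : perm_eq [seq x * y | y <- C] C.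
    have u : uniq [seq x * y | y <- C] by rewrite map_inj_uniq ?fset_uniq //; apply: mulfI.
    have sub : {subset [seq x * y | y <- C] <= C}.
      by move=> _ /mapP[y + ->]; rewrite !inC mulf_eq0 negb_or x0 => /andP[-> yA]; rewrite AM.
    have [|_ e] := uniq_min_size u sub; first by rewrite size_map.
    by apply: uniq_perm => //; apply: fset_uniq.
  have Cn0 : \prod_(y <- C) y != 0.
    by rewrite prodf_seq_neq0; apply/allP => y; rewrite inC => /andP[].
  have : \prod_(y <- [seq x * y | y <- C]) y = \prod_(y <- C) y by exact: perm_big.
  rewrite big_map big_split /= big_const_seq count_predT iter_mulr_1.
  rewrite -[RHS]mul1r => /(mulIf Cn0) x1.
  by rewrite -sC exprS x1 mulr1.
apply/seteqP; split=> // x Fx; apply: contrapT => nAx0.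
have nAx := memNset nAx0.
pose P : {poly K} := 'X^(p ^ m) - 'X.
have sP : size P = (p ^ m).+1.
  by rewrite size_polyDl ?size_polyXn // size_polyN size_polyX -sC.
have P0 : P != 0 by rewrite -size_poly_eq0 sP.
have rP y : GFset K p m y -> root P y.
  by rewrite /GFset /= rootE !hornerE subr_eq0 => ->.
have rB : all (root P) (x :: B).
  rewrite /= rP //=; apply/allP => y; rewrite inB => /set_mem yA.
  by apply: rP; apply: AF.
have := max_poly_roots P0 rB; rewrite /= inB nAx fset_uniq sP => /(_ isT).
by rewrite sB ltnn.
Qed.

(* Main.v *)
Require Import Defs.
From HB Require Import structures.
From mathcomp Require Import all_boot all_order all_algebra all_field.
From mathcomp Require Import finmap.
From mathcomp Require Import boolp classical_sets functions cardinality.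

Set Implicit Arguments.
Unset Strict Implicit.
Unset Printing Implicit Defensive.

Import GRing.Theory.

Local Open Scope classical_set_scope.
Local Open Scope card_scope.
Local Open Scope ring_scope.

(* Write s for the Frobenius map. As k/l is odd, the alternating sum telescopes
   to S_l^k(x) + s^l(S_l^k(x)) = x + s^k(x), so every zero x satisfies
   s^k(x) = -x and s^(2k)(x) = x. If n/d is odd, x then lies in F_(p^d), so
   that s^k(x) = x and 2x = 0; when d = e, moreover, s^l(x) = x and
   S_l^k(x) = x. Either way x = 0. If n/d is even, the zeros lie in
   V = {x | s^d(x) = -x}, a subset of F_(p^n). On V the map m = -s^e satisfies
   m^(d/e) = 1 and -s^l = m^(l/e) with l/e prime to d/e, so that
   S_l^k = (k/L) S_e^d there. Hence the zero set is V or the zero set of S_e^d.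
   Both are sets of simple roots, which gives the cardinalities; and since
   (1 + s^d)(1 - s^d) = 1 - s^(2d) = S_e^d o S_d^(2d) o T_e^(2e), any preimage
   in the algebraic closure of a zero automatically lies in F_(p^(2d)). *)

(** * Arithmetic of gcds and periodic sums *)

Lemma odd_divn_gcdn (d l k : nat) :
  (0 < k)%N -> (d %| k)%N -> (l %| k)%N -> odd (k %/ l) -> odd (d %/ gcdn d l).
Proof.
move=> k0 dk lk; have l0 := dvdn_gt0 k0 lk.
(* [d %/ gcdn d l] equals [lcmn d l %/ l], and [lcmn d l] divides [k]. *)
have : (d %/ gcdn d l %| k %/ l)%N.
  rewrite -(dvdn_pmul2r l0) (divnK lk) mulnC muln_divA ?dvdn_gcdl // mulnC.
  by rewrite -[(_ %/ _)%N]/(lcmn d l) dvdn_lcm dk.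
by case/dvdnP=> q ->; rewrite oddM => /andP[].
Qed.

Lemma coprime_divn_gcdn (n m : nat) :
  (0 < n)%N -> coprime (n %/ gcdn n m) (m %/ gcdn n m).
Proof.
move=> n0; set d := gcdn n m; have d0 : (0 < d)%N by rewrite gcdn_gt0 n0.
rewrite /coprime -(eqn_pmul2r d0) muln_gcdl.
by rewrite !divnK ?mul1n ?dvdn_gcdl ?dvdn_gcdr.
Qed.

Lemma periodic_muln (T : Type) (f : nat -> T) (D j i : nat) :
  (forall i, f (i + D)%N = f i) -> f (i + j * D)%N = f i.
Proof.
move=> fD; elim: j => [|j IH]; first by rewrite addn0.
by rewrite mulSn addnA addnAC fD.
Qed.

Lemma sum_periodic (V : nmodType) (f : nat -> V) (D q : nat) :
  (forall i, f (i + D)%N = f i) ->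
  \sum_(i < q * D) f i = (\sum_(i < D) f i) *+ q.
Proof.
move=> fD; elim: q => [|q IH]; first by rewrite big_ord0.
rewrite mulSnr big_split_ord /= IH mulrSr; congr (_ + _).
by apply: eq_bigr => i _; rewrite addnC periodic_muln.
Qed.

(** Multiplication by [a] permutes the residues modulo [D], and [f] depends only on the residue of
    its argument. *)
Lemma sum_periodic_coprime (V : nmodType) (f : nat -> V) (D a : nat) :
  (0 < D)%N -> coprime D a -> (forall i, f (i + D)%N = f i) ->
  \sum_(i < D) f (a * i)%N = \sum_(i < D) f i.
Proof.
case: D => // D _ cDa fD.
have fm i : f (i %% D.+1)%N = f i.
  by rewrite [in RHS](divn_eq i D.+1) addnC periodic_muln.
pose h (i : 'I_D.+1) : 'I_D.+1 := inord ((a * i) %% D.+1).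
have hE i : h i = ((a * i) %% D.+1)%N :> nat by rewrite inordK // ltn_mod.
have hinj : injective h.
  move=> i j /(congr1 val); rewrite /= !hE => hij; apply: val_inj.
  wlog lij : i j hij / (i <= j)%N.
    by move=> W; case: (leqP i j) => [|/ltnW] /W; [apply | move=> ->].
  have : (a * j == a * i %[mod D.+1])%N by rewrite hij.
  rewrite eqn_mod_dvd ?leq_mul2l ?lij ?orbT // -mulnBr Gauss_dvdr //.
  by rewrite -eqn_mod_dvd // !modn_small // => /eqP.
rewrite [RHS](reindex_inj hinj).
by apply: eq_bigr => i _; rewrite hE fm.
Qed.

Lemma sum_signr_odd (R : pzRingType) (m : nat) :
  odd m -> \sum_(i < m) (-1) ^+ i = 1 :> R.
Proof.
suff -> : \sum_(i < m) (-1) ^+ i = (odd m)%:R :> R by move=> ->.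
elim: m => [|m IH]; first by rewrite big_ord0.
rewrite big_ord_recr /= IH -signr_odd.
by case: (odd m); rewrite /= ?expr1 ?expr0 ?subrr ?add0r.
Qed.

(** * Surjectivity and root counts over a closed field *)

Lemma horner_surj (K : closedFieldType) (F : {poly K}) (c : K) :
  (1 < size F)%N -> exists y, F.[y] = c.
Proof.
move=> sF; have sFc : size (F - c%:P) = size F.
  by rewrite size_polyDl // size_polyN (leq_ltn_trans (size_polyC_leq1 _)).
have /closed_rootP[y] : size (F - c%:P) != 1%N by rewrite sFc neq_ltn sF orbT.
by rewrite rootE !hornerE subr_eq0 => /eqP; exists y.
Qed.

(** Over a closed field a separable polynomial splits into distinct linear factors. *)
Lemma card_roots_separable (K : closedFieldType) (P : {poly K}) :
  P != 0 -> separable_poly P ->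
  [set x | P.[x] = 0] #= `I_(size P).-1.
Proof.
move=> P0 sepP; have [r Pr] := closed_field_poly_normal P.
have lP : lead_coef P != 0 by rewrite lead_coef_eq0.
have ur : uniq r.
  by rewrite -separable_prod_XsubC -(eqp_separable (eqp_scale _ lP)) -Pr.
have sr : size r = (size P).-1.
  by rewrite Pr size_scale // size_prod_XsubC.
have rP x : (x \in r) = (P.[x] == 0).
  by rewrite -root_prod_XsubC -(rootZ _ _ lP) -Pr rootE.
have -> : [set x | P.[x] = 0] = [set` [fset x in r]%fset].
  by apply/seteqP; split=> x /=; rewrite !inE /= rP => /eqP.
by apply/card_eq_fsetP; rewrite card_fseq undup_id.
Qed.

(** * Powers of the Frobenius map and the linearized polynomials *)

Section Frobenius.
Variables (K : closedFieldType) (p : nat).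
Hypothesis pK : p \in [pchar K].
Implicit Types (x y : K) (a b i m u v : nat).

Let pX_nat m : [pchar K].-nat (p ^ m)%N.
Proof.
by rewrite (eq_pnat _ (pcharf_eq pK)) pnatX pnat_id ?(pcharf_prime pK).
Qed.

Let pX_gt1 m : (0 < m)%N -> (1 < p ^ m)%N.
Proof.
by move=> m0; rewrite -(exp1n m) ltn_exp2r // prime_gt1 ?(pcharf_prime pK).
Qed.

Lemma FrobD m x y : (x + y) ^+ (p ^ m) = x ^+ (p ^ m) + y ^+ (p ^ m).
Proof. exact: exprDn_pchar. Qed.

Lemma FrobN m x : (- x) ^+ (p ^ m) = - x ^+ (p ^ m).
Proof. exact: exprNn_pchar. Qed.

Lemma Frob0 m : (0 : K) ^+ (p ^ m) = 0.
Proof. by rewrite expr0n expn_eq0 gtn_eqF // prime_gt0 ?(pcharf_prime pK). Qed.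

Lemma Frob_sign m i x : ((-1) ^+ i * x) ^+ (p ^ m) = (-1) ^+ i * x ^+ (p ^ m).
Proof. by rewrite exprMn exprAC FrobN expr1n. Qed.

Lemma Frob_add a b x : x ^+ (p ^ (a + b)) = (x ^+ (p ^ a)) ^+ (p ^ b).
Proof. by rewrite expnD exprM. Qed.

Lemma Frob_opp_mul a i x :
  x ^+ (p ^ a) = - x -> x ^+ (p ^ (a * i)) = (-1) ^+ i * x.
Proof.
move=> xa; elim: i => [|i IH]; first by rewrite muln0 expr1 expr0 mul1r.
by rewrite mulnS Frob_add xa FrobN IH exprS mulN1r mulNr.
Qed.

Lemma Frob_fix_mul a i x :
  x ^+ (p ^ a) = x -> x ^+ (p ^ (a * i)) = x.
Proof.
move=> xa; elim: i => [|i IH]; first by rewrite muln0 expr1.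
by rewrite mulnS Frob_add xa.
Qed.

(** Bezout writes a multiple of [a] as a multiple of [b] plus [gcdn a b], and both multiples act
    trivially on [x]. *)
Lemma Frob_fix_gcd a b x : (0 < a)%N ->
  x ^+ (p ^ a) = x -> x ^+ (p ^ b) = x -> x ^+ (p ^ gcdn a b) = x.
Proof.
move=> a0 xa xb; case: (egcdnP b a0) => i j + _; rewrite mulnC => ij.
have := Frob_fix_mul i xa; rewrite ij Frob_add [(j * b)%N]mulnC.
by rewrite (Frob_fix_mul j xb).
Qed.

Lemma horner_Spoly u v x :
  (Spoly K p u v).[x] = \sum_(i < v %/ u) (-1) ^+ i * x ^+ (p ^ (u * i)).
Proof.
rewrite /Spoly big_mkord horner_sum; apply: eq_bigr => i _.
by rewrite hornerZ hornerXn.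
Qed.

Lemma horner_Spoly_double u x :
  (0 < u)%N -> (Spoly K p u (2 * u)).[x] = x - x ^+ (p ^ u).
Proof. by move=> u0; rewrite Spoly_double // !hornerE. Qed.

Lemma horner_Tpoly_double u x :
  (0 < u)%N -> (Tpoly K p u (2 * u)).[x] = x + x ^+ (p ^ u).
Proof. by move=> u0; rewrite Tpoly_double // !hornerE. Qed.

Lemma Frob_horner_Spoly m u v x :
  (Spoly K p u v).[x] ^+ (p ^ m) = (Spoly K p u v).[x ^+ (p ^ m)].
Proof.
rewrite !horner_Spoly (big_morph _ (FrobD m) (Frob0 m)).
by apply: eq_bigr => i _; rewrite Frob_sign -!exprM mulnC.
Qed.

(** s^u shifts every index by one and keeps the signs, so consecutive terms cancel; oddness of
    [v %/ u] turns the last sign into a plus. *)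
Lemma Spoly_telescope u v x : (u %| v)%N -> odd (v %/ u) ->
  (Spoly K p u v).[x] + (Spoly K p u v).[x] ^+ (p ^ u) = x + x ^+ (p ^ v).
Proof.
move=> uv om; have tele m :
    let s := \sum_(i < m) (-1) ^+ i * x ^+ (p ^ (u * i)) in
    s + s ^+ (p ^ u) = x - (-1) ^+ m * x ^+ (p ^ (u * m)).
  elim: m => [|m IH] /=.
    by rewrite !big_ord0 Frob0 muln0 expr1 expr0 mul1r subrr addr0.
  rewrite !big_ord_recr /= FrobD Frob_sign -Frob_add -mulnSr addrACA IH.
  by rewrite exprS mulN1r mulNr opprK addrA subrK.
rewrite !horner_Spoly tele mulnC (divnK uv) -signr_odd om.
by rewrite expr1 mulN1r opprK.
Qed.

(** * Simple roots and degrees *)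

Lemma deriv_Xp a : (0 < a)%N -> ('X^(p ^ a) : {poly K})^`() = 0.
Proof.
case: a => // a _.
rewrite derivXn -mulr_natl natrX -(rmorph_nat polyC) (pcharf0 pK).
by rewrite expr0n mul0r.
Qed.

Lemma Tpoly_double_separable u :
  (0 < u)%N -> separable_poly (Tpoly K p u (2 * u)).
Proof.
move=> u0; rewrite Tpoly_double // unlock derivD derivX deriv_Xp // addr0.
exact: coprimep1.
Qed.

Lemma size_Tpoly_double u :
  (0 < u)%N -> size (Tpoly K p u (2 * u)) = (p ^ u).+1.
Proof.
move=> u0; rewrite Tpoly_double // addrC size_polyDl ?size_polyXn //.
by rewrite size_polyX ltnS pX_gt1.
Qed.

Lemma size_Spoly_double u :
  (0 < u)%N -> size (Spoly K p u (2 * u)) = (p ^ u).+1.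
Proof.
move=> u0; rewrite Spoly_double // addrC size_polyDl size_polyN ?size_polyXn //.
by rewrite size_polyX ltnS pX_gt1.
Qed.

(** Only the term ['X] has a nonzero derivative, so the derivative is 1. *)
Lemma Spoly_separable u v :
  (0 < u)%N -> (0 < v %/ u)%N -> separable_poly (Spoly K p u v).
Proof.
move=> u0 m0; rewrite unlock.
suff -> : (Spoly K p u v)^`() = 1 by exact: coprimep1.
rewrite /Spoly; case: (v %/ u)%N m0 => // m _.
rewrite big_nat_recl // muln0 expr1 expr0 scale1r derivD derivX.
rewrite raddf_sum big1 ?addr0 //= => i _.
by rewrite derivZ deriv_Xp ?scaler0 // muln_gt0 u0.
Qed.

Lemma size_Spoly u v :
  (0 < u)%N -> (0 < v %/ u)%N -> (u %| v)%N ->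
  size (Spoly K p u v) = (p ^ (v - u)).+1.
Proof.
move=> u0 + /divnK {2}<-; rewrite /Spoly; case: (v %/ u)%N => // m _.
rewrite mulSn addKn mulnC big_nat_recr //=.
have sX i : size ((-1) ^+ i *: 'X^(p ^ (u * i)) : {poly K}) = (p ^ (u * i)).+1.
  by rewrite size_scale ?size_polyXn // signr_eq0.
rewrite addrC size_polyDl sX // ltnS.
rewrite big_mkord (leq_trans (size_sum _ _ _)) //.
apply/bigmax_leqP => i _; rewrite sX ltn_exp2l ?ltn_pmul2l //.
by rewrite prime_gt1 ?(pcharf_prime pK).
Qed.

(** * Reduction of S_l^k to S_e^d where s^d acts as -1 *)

(** Put f(i) = m^i(x) with m = -s^e. As [D] is odd, (-1)^D cancels the sign in s^(eD)(x) = -x, so f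
    has period [D]; as [a] is odd, (-1)^i = (-1)^(ai), so the left side sums the values f(ai). *)
Lemma sum_sign_Frob_opp e D a q x :
  odd D -> odd a -> coprime D a -> x ^+ (p ^ (e * D)) = - x ->
  \sum_(i < q * D) (-1) ^+ i * x ^+ (p ^ (e * a * i)) =
  (\sum_(i < D) (-1) ^+ i * x ^+ (p ^ (e * i))) *+ q.
Proof.
move=> oD oa cDa xD; pose f i := (-1) ^+ i * x ^+ (p ^ (e * i)).
have fD i : f (i + D)%N = f i.
  rewrite /f addnC mulnDr Frob_add xD FrobN -[_ ^+ (D + i)]signr_odd oddD oD.
  by rewrite signr_addb signr_odd expr1 mulN1r mulrNN.
have fa i : f (a * i)%N = (-1) ^+ i * x ^+ (p ^ (e * a * i)).
  by rewrite /f mulnA -signr_odd oddM oa /= signr_odd.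
rewrite -(sum_periodic_coprime (odd_gt0 oD) cDa fD).
rewrite -(sum_periodic (f := fun i => f (a * i)%N)).
  by apply: eq_bigr => i _; rewrite fa.
by move=> i; rewrite mulnDr periodic_muln.
Qed.

Lemma Spoly_Frob_opp d l k x :
  let e := gcdn d l in
  (0 < k)%N -> (d %| k)%N -> (l %| k)%N -> odd (k %/ l) -> odd (k %/ d) ->
  x ^+ (p ^ d) = - x ->
  (Spoly K p l k).[x] = (Spoly K p e d).[x] *+ (k %/ lcmn d l).
Proof.
move=> e k0 dk lk okl okd xd.
have l0 := dvdn_gt0 k0 lk; have e0 : (0 < e)%N by rewrite gcdn_gt0 l0 orbT.
(* With d = eD, l = ea and k = qeDa, the odd quotients k/l and k/d become qD and qa, so [D] and [a]
   are odd. *)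
have [D dD] : exists D, d = (e * D)%N.
  by case/dvdnP: (dvdn_gcdl d l) => D; exists D; rewrite mulnC.
have [a la] : exists a, l = (e * a)%N.
  by case/dvdnP: (dvdn_gcdr d l) => a; exists a; rewrite mulnC.
have cDa : coprime D a.
  by rewrite /coprime -(eqn_pmul2l e0) muln_gcdr -dD -la muln1.
have LE : lcmn d l = (e * D * a)%N.
  apply/eqP; rewrite -(eqn_pmul2r e0) muln_lcm_gcd {1}dD {1}la.
  by rewrite -!mulnA (mulnC e a).
have [q kq] : exists q, k = (q * (e * D * a))%N.
  by rewrite -LE; apply/dvdnP; rewrite dvdn_lcm dk.
have {}LE : (k %/ lcmn d l)%N = q.
  by rewrite LE kq mulnK // -LE lcmn_gt0 (dvdn_gt0 k0 dk).
have klE : (k %/ l)%N = (q * D)%N.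
  by rewrite kq mulnAC -la mulnCA mulKn.
have kdE : (k %/ d)%N = (q * a)%N.
  by rewrite kq -dD mulnCA mulKn // (dvdn_gt0 k0 dk).
move: okl okd; rewrite klE kdE !oddM => /andP[_ oD] /andP[_ oa].
rewrite !horner_Spoly LE klE [in LHS]la [X in (X %/ e)%N]dD mulKn //.
by rewrite sum_sign_Frob_opp // -dD.
Qed.

(** * Zeros as points negated by Frobenius powers, and the case n/d even *)

Lemma Frob_opp_of_Spoly0 l k x : (l %| k)%N -> odd (k %/ l) ->
  (Spoly K p l k).[x] = 0 -> x ^+ (p ^ k) = - x.
Proof.
move=> lk okl S0; have := Spoly_telescope x lk okl.
by rewrite S0 Frob0 addr0 => /esym/eqP; rewrite addrC addr_eq0 => /eqP.
Qed.

Lemma Frob_opp_gcd n k x : (0 < n)%N -> ~~ odd (n %/ gcdn n k) ->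
  (x ^+ (p ^ n) = x /\ x ^+ (p ^ k) = - x) <-> x ^+ (p ^ gcdn n k) = - x.
Proof.
move=> n0; set d := gcdn n k => en.
have d0 : (0 < d)%N by rewrite gcdn_gt0 n0.
have dn : (d %| n)%N by exact: dvdn_gcdl.
have dk : (d %| k)%N by exact: dvdn_gcdr.
have [h nh] : exists h, n = (d * 2 * h)%N.
  by exists (n %/ d)./2; rewrite -mulnA mul2n even_halfK // mulnC divnK.
have ndE : (n %/ d = 2 * h)%N by rewrite nh -mulnA mulKn.
have := coprime_divn_gcdn k n0; rewrite -/d ndE coprimeMl.
rewrite coprime2n => /andP[ok chk].
split=> [[xn xk]|xd].
- have x2k : x ^+ (p ^ (k * 2)) = x.
    by rewrite (Frob_opp_mul 2 xk) sqrrN expr1n mul1r.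
  (* Here n = 2dh and 2k = 2d(k/d), with h prime to k/d. *)
  have gE : gcdn n (k * 2) = (d * 2)%N.
    have -> : (k * 2 = d * 2 * (k %/ d))%N by rewrite mulnAC (mulnC d) divnK.
    by rewrite nh -muln_gcdr (eqP chk) muln1.
  have := Frob_fix_gcd n0 xn x2k; rewrite gE => x2d.
  (* [k] is an odd multiple of [d] and s^(2d) fixes [x], so s^k and s^d agree on [x]. *)
  rewrite -xk -(divnK dk) mulnC -(odd_double_half (k %/ d)) ok.
  by rewrite mulnDr -mul2n mulnA muln1 addnC Frob_add Frob_fix_mul.
- have x2d : x ^+ (p ^ (d * 2)) = x.
    by rewrite (Frob_opp_mul 2 xd) sqrrN expr1n mul1r.
  split; first by rewrite nh Frob_fix_mul.
  by rewrite -(divnK dk) mulnC (Frob_opp_mul _ xd) -signr_odd ok expr1 mulN1r.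
Qed.

(** Either branch is the zero set of a single separable polynomial, from which both the cardinality
    and the description as an image are read off. *)
Lemma Spoly_zeros n k l :
  let d := gcdn n k in let e := gcdn d l in
  (0 < n)%N -> (0 < k)%N -> (l %| k)%N -> odd (k %/ l) -> ~~ odd (n %/ d) ->
  [set x : K | GFset K p n x /\ (Spoly K p l k).[x] = 0] =
  [set x | (if (p %| k %/ lcmn d l)%N
            then Tpoly K p d (2 * d) else Spoly K p e d).[x] = 0].
Proof.
move=> d e n0 k0 lk okl en.
have d0 : (0 < d)%N by rewrite gcdn_gt0 n0.
have dk : (d %| k)%N by exact: dvdn_gcdr.
have l0 := dvdn_gt0 k0 lk.
have e0 : (0 < e)%N by rewrite gcdn_gt0 l0 orbT.
(* [k %/ d] is prime to the even number [n %/ d]. *)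
have okd : odd (k %/ d).
  have := coprime_divn_gcdn k n0; rewrite -/d -(even_halfK en) -muln2 coprimeMl.
  by rewrite coprime2n => /andP[].
have ed : (e %| d)%N by exact: dvdn_gcdl.
have ode : odd (d %/ e) by apply: odd_divn_gcdn dk lk okl.
have main x : (GFset K p n x /\ (Spoly K p l k).[x] = 0) <->
    x ^+ (p ^ d) = - x /\ (Spoly K p e d).[x] *+ (k %/ lcmn d l) = 0.
  split=> [[xn S0]|[xd S0]].
    have xd : x ^+ (p ^ d) = - x.
      apply/(Frob_opp_gcd x n0 en); split=> //.
      exact: Frob_opp_of_Spoly0 S0.
    by rewrite -(Spoly_Frob_opp k0 dk).
  by rewrite (Spoly_Frob_opp k0 dk) //; case/(Frob_opp_gcd x n0 en): xd.
apply/seteqP; rewrite /mkset; split=> x; rewrite main -mulr_natr.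
(* The scalar k/L vanishes in [K] exactly when [p] divides it. *)
all: case: ifPn; rewrite (dvdn_pcharf pK) => pq.
- by case=> xd _; rewrite horner_Tpoly_double // xd subrr.
- by case=> _ /eqP; rewrite mulf_eq0 (negbTE pq) orbF => /eqP.
- rewrite horner_Tpoly_double // addrC => /eqP; rewrite addr_eq0 => /eqP xd.
  by rewrite (eqP pq) mulr0.
(* Since d/e is odd, s^d negates every zero of S_e^d. *)
- by move=> S0; rewrite S0 mul0r (Frob_opp_of_Spoly0 ed ode S0).
Qed.

(** * The zero sets as images of F_(p^(2d)) *)

Lemma horner_SpolyB u v x y :
  (Spoly K p u v).[x - y] = (Spoly K p u v).[x] - (Spoly K p u v).[y].
Proof.
rewrite !horner_Spoly -sumrB; apply: eq_bigr => i _.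
by rewrite FrobD FrobN mulrBr.
Qed.

Lemma horner_SpolyD u v x y :
  (Spoly K p u v).[x + y] = (Spoly K p u v).[x] + (Spoly K p u v).[y].
Proof.
rewrite !horner_Spoly -big_split; apply: eq_bigr => i _.
by rewrite FrobD mulrDr.
Qed.

Lemma Tpoly_Spoly_double d y : (0 < d)%N ->
  (Tpoly K p d (2 * d)).[(Spoly K p d (2 * d)).[y]] = y - y ^+ (p ^ (2 * d)).
Proof.
move=> d0; rewrite horner_Tpoly_double // horner_Spoly_double //.
by rewrite FrobD FrobN -Frob_add addnn -mul2n addrA subrK.
Qed.

(** S_e^d is additive and commutes with s, so it telescopes on T_e^(2e)(y) to y + s^d(y);
    subtracting the image of this under s^d leaves the two end terms. *)
Lemma Spoly_comp_double e d y :
  (0 < e)%N -> (0 < d)%N -> (e %| d)%N -> odd (d %/ e) ->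
  (Spoly K p e d).[(Spoly K p d (2 * d) \Po Tpoly K p e (2 * e)).[y]] =
  y - y ^+ (p ^ (2 * d)).
Proof.
move=> e0 d0 ed ode; rewrite horner_comp horner_Spoly_double //.
rewrite horner_SpolyB -Frob_horner_Spoly horner_Tpoly_double //.
rewrite horner_SpolyD -Frob_horner_Spoly Spoly_telescope //.
by rewrite FrobD -Frob_add addnn -mul2n addrKA.
Qed.

(** As G o F is 1 - s^m, a point lies in F_(p^m) exactly when [F] sends it to a zero of [G]. *)
Lemma poly_image_GFset (F G : {poly K}) m :
  (forall x, exists y, F.[y] = x) ->
  (forall y, G.[F.[y]] = y - y ^+ (p ^ m)) ->
  poly_image F (GFset K p m) = [set x | G.[x] = 0].
Proof.
move=> Fsurj GF; apply/seteqP; split=> [_ [y ym <-]|x /= Gx] /=.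
  by rewrite GF (ym : _ = _) subrr.
have [y yx] := Fsurj x; exists y => //.
by apply/esym/eqP; rewrite -subr_eq0 -GF yx Gx.
Qed.

(** * The case n/d odd *)

Lemma Spoly_zeros_odd n k l x : (0 < n)%N -> (l %| k)%N ->
  odd (k %/ l) -> odd (n %/ gcdn n k) -> odd p \/ (gcdn n k %| l)%N ->
  x ^+ (p ^ n) = x -> (Spoly K p l k).[x] = 0 -> x = 0.
Proof.
move=> n0 lk okl; set d := gcdn n k => ond pd xn S0.
have d0 : (0 < d)%N by rewrite gcdn_gt0 n0.
have dn : (d %| n)%N by exact: dvdn_gcdl.
have dk : (d %| k)%N by exact: dvdn_gcdr.
have xk := Frob_opp_of_Spoly0 lk okl S0.
have x2k : x ^+ (p ^ (k * 2)) = x.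
  by rewrite (Frob_opp_mul 2 xk) sqrrN expr1n mul1r.
(* The odd number n/d is prime to 2, so doubling [k] leaves the gcd unchanged. *)
have gE : gcdn n (k * 2) = d.
  rewrite -{1}(divnK dn) -{1}(divnK dk) mulnAC -muln_gcdl.
  by rewrite Gauss_gcdl ?coprimen2 // muln_gcdl !divnK.
have := Frob_fix_gcd n0 xn x2k; rewrite gE => xd.
(* For odd [p], x = -x forces x = 0; for p = 2 it says nothing. If [d] divides [l], then s^l fixes
   [x] and the alternating sum of odd length collapses to [x] in any characteristic. *)
case: pd => [op|/divnK dl].
  have xN : x = - x by rewrite -xk -(divnK dk) mulnC Frob_fix_mul.
  have : x * 2%:R == 0 by rewrite mulr_natr mulr2n {2}xN subrr.
  rewrite mulf_eq0 -(dvdn_pcharf pK) dvdn_prime2 ?(pcharf_prime pK) //.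
  by case/orP=> /eqP // p2; rewrite p2 in op.
have xl : x ^+ (p ^ l) = x by rewrite -dl mulnC Frob_fix_mul.
move: S0; rewrite horner_Spoly; under eq_bigr do rewrite Frob_fix_mul //.
by rewrite -mulr_suml sum_signr_odd // mul1r.
Qed.

End Frobenius.

Theorem theorem3 (p : nat) (hp : prime p)
    (K : closedFieldType) (iota : {rmorphism 'F_p -> K})
    (K_algebraic : integralRange iota)
    (n k l : nat) (hn : (0 < n)%N) (hk : (0 < k)%N) (hl : (0 < l)%N)
    (hlk : (l %| k)%N) :
  let d := gcdn n k in
  let e := gcdn n l in
  let L := lcmn d l in
  let Z := [set x : K | GFset K p n x /\ (Spoly K p l k).[x] = 0] in
  odd (k %/ l) ->
  (odd (n %/ d) -> (odd p \/ d = e) ->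
     Z = [set 0] /\ Z #= `I_1)
  /\
  (~~ odd (n %/ d) ->
     Z = (if (p %| k %/ L)%N
          then poly_image (Spoly K p d (2 * d)) (GFset K p (2 * d))
          else poly_image (Spoly K p d (2 * d) \Po Tpoly K p e (2 * e))
                          (GFset K p (2 * d)))
     /\
     Z #= `I_(if (p %| k %/ L)%N then p ^ d else p ^ (d - e))).
Proof.
move=> d e L Z okl.
have pK : p \in [pchar K] by rewrite (fmorph_pchar iota) pchar_Fp.
have d0 : (0 < d)%N by rewrite gcdn_gt0 hn.
have e0 : (0 < e)%N by rewrite gcdn_gt0 hn.
(* As [l] divides [k], gcd(n, gcd(k, l)) is gcd(n, l). *)
have eE : e = gcdn d l by rewrite /e -gcdnA (gcdn_idPr hlk).
split=> [ond pd|end_].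
  have -> : Z = [set 0].
    apply/seteqP; split=> x /=; last first.
      move=> ->; split; first exact: Frob0.
      (* Additivity at 0 - 0 gives S_l^k(0) = 0. *)
      by have := horner_SpolyB pK l k 0 0; rewrite !subrr.
    case; apply: Spoly_zeros_odd => //.
    by case: pd => [|de]; [left | right; rewrite -/d de dvdn_gcdr].
  by split=> //; apply: card_set1.
have ed : (e %| d)%N by rewrite eE dvdn_gcdl.
have ode : odd (d %/ e) by rewrite eE (odd_divn_gcdn hk _ hlk) ?dvdn_gcdr.
have ZE := Spoly_zeros pK hn hk hlk okl end_.
rewrite -/d -eE -/L -/Z in ZE; rewrite ZE; case: ifP => _.
  split.
    apply/esym/poly_image_GFset => [x|y]; last exact: Tpoly_Spoly_double.
    by apply: horner_surj; rewrite size_Spoly_double // ltnS expn_gt0 prime_gt0.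
  have -> : (p ^ d = (size (Tpoly K p d (2 * d))).-1)%N.
    by rewrite size_Tpoly_double.
  apply: card_roots_separable; last exact: Tpoly_double_separable.
  by rewrite -size_poly_eq0 size_Tpoly_double.
have de0 := odd_gt0 ode; split.
  apply/esym/poly_image_GFset => [x|y]; last exact: Spoly_comp_double.
  have [y <-] : exists y, (Spoly K p d (2 * d)).[y] = x.
    by apply: horner_surj; rewrite size_Spoly_double // ltnS expn_gt0 prime_gt0.
  have [z <-] : exists z, (Tpoly K p e (2 * e)).[z] = y.
    by apply: horner_surj; rewrite size_Tpoly_double // ltnS expn_gt0 prime_gt0.
  by exists z; rewrite horner_comp.
(* All roots being simple, the count is the degree of S_e^d. *)
have -> : (p ^ (d - e) = (size (Spoly K p e d)).-1)%N by rewrite size_Spoly.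
apply: card_roots_separable; last exact: Spoly_separable.
by rewrite -size_poly_eq0 size_Spoly.
Qed.
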